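(* Let $\mathcal{M}$ be the $[0,\infty]$-category with the same objects as the syntax category $\mathcal{L}$ and $\mathcal{M}(x,y)=-\ln\mathcal{L}(x,y)$. For any copresheaves $f,g\in\widehat{\mathcal{M}}$ and any weights $w_1,w_2\in[0,\infty]$, the weighted product $(w_1,f)\times(w_2,g)$ and the weighted coproduct $(w_1,f)\sqcup(w_2,g)$ of $f$ and $g$ in $\widehat{\mathcal{M}}$ are given, for all $c\in\mathcal{M}$, by $$((w_1,f)\times(w_2,g))(c)=\max\{fc-w_1,\;gc-w_2,\;0\},$$ $$((w_1,f)\sqcup(w_2,g))(c)=\min\{fc+w_1,\;gc+w_2\}.$$
   Context: The syntax category $\mathcal{L}$ has as objects the expressions (texts) of a language and hom objects $\mathcal{L}(x,y):=\pi(y|x)\in[0,1]$, the probability that $y$ extends $x$, with $\pi(y|x)=0$ if $x$ is not a subtext of $y$, $\pi(x|x)=1$, and $\pi(z|y)\pi(y|x)\le\pi(z|x)$ for all $x,y,z$ (i.e. $\mathcal{L}$ is a category enriched over $[0,1]$). With $-\ln 0=\infty$, the numbers $\mathcal{M}(x,y)=d_{\mathcal{M}}(x,y)\in[0,\infty]$ satisfy $\mathcal{M}(x,x)=0$ and $\mathcal{M}(x,y)+\mathcal{M}(y,z)\ge\mathcal{M}(x,z)$, so $\mathcal{M}$ is a $[0,\infty]$-category (generalized metric space). Here $[0,\infty]$ is a closed commutative monoidal preorder under addition (with $a+\infty=\infty$), with a morphism $a\to b$ exactly when $b\le a$; its internal hom is truncated subtraction $[a,b]:=\max\{b-a,0\}$,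 where $b-\infty$ is understood to be $\le 0$ for every $b\in[0,\infty]$ (so $[\infty,b]=0$ for all $b$, including $b=\infty$). The same convention is used for $fc-w_1$ and $gc-w_2$ in the claim. A $[0,\infty]$-copresheaf on $\mathcal{M}$ is a function $f\colon\mathcal{M}\to[0,\infty]$ with $\mathcal{M}(x,y)\ge[fx,fy]$ for all $x,y$. The $[0,\infty]$-category $\widehat{\mathcal{M}}$ of copresheaves has hom objects $\widehat{\mathcal{M}}(f,g)=\sup_{x\in\mathcal{M}}[fx,gx]$. The weighted product $(w_1,f)\times(w_2,g)$ is the weighted limit of the two-object discrete diagram $f,g$ with weights $w_1,w_2$: the copresheaf $P$ with $\widehat{\mathcal{M}}(Z,P)=\max\{[w_1,\widehat{\mathcal{M}}(Z,f)],[w_2,\widehat{\mathcal{M}}(Z,g)]\}$ for every copresheaf $Z$. The weighted coproduct $(w_1,f)\sqcup(w_2,g)$ is the corresponding weighted colimit: the copresheaf $Q$ with $\widehat{\mathcal{M}}(Q,Z)=\max\{[w_1,\widehat{\mathcal{M}}(f,Z)],[w_2,\widehat{\mathcal{M}}(g,Z)]\}$ for every copresheaf $Z$. *)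

(* Defs.v *)
From HB Require Import structures.
From mathcomp Require Import all_boot all_order all_algebra.
From mathcomp Require Import all_classical all_reals all_analysis.

Set Implicit Arguments.
Unset Strict Implicit.
Unset Printing Implicit Defensive.

Import Order.TTheory GRing.Theory Num.Theory.

Local Open Scope classical_set_scope.
Local Open Scope ring_scope.
Local Open Scope ereal_scope.

(* The monoidal preorder [0, +oo] is represented by the nonnegative elements
   of \bar R; nonnegativity is a field or a hypothesis wherever needed. *)

(* Internal hom [a, b] of [0, +oo].  In \bar R one has +oo - +oo = -oo, hence
   b - +oo = -oo for every b, and [+oo, b] = 0 including for b = +oo. *)
Definition ihom (R : realType) (a b : \bar R) : \bar R := maxe (b - a) 0.

(* [0, +oo]-categories, i.e. generalized metric spaces. *)
Record gmetric (R : realType) := GMetric {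
  gm_obj :> Type;
  gm_hom : gm_obj -> gm_obj -> \bar R;
  gm_hom_ge0 : forall x y, 0 <= gm_hom x y;
  gm_hom_refl : forall x, gm_hom x x = 0;
  gm_hom_triangle : forall x y z, gm_hom x z <= gm_hom x y + gm_hom y z
}.

(* A language is a set of words over an alphabet of tokens; x is a subtext of
   y when it occurs in y as a contiguous factor.  [sc_pi x y] is pi(y|x). *)
Record syntax_category (R : realType) := SyntaxCategory {
  sc_token : eqType;
  sc_lang : {pred seq sc_token};
  sc_pi : {x | x \in sc_lang} -> {x | x \in sc_lang} -> R;
  sc_pi_ge0 : forall x y, (0 <= sc_pi x y)%R;
  sc_pi_le1 : forall x y, (sc_pi x y <= 1)%R;
  sc_pi_subtext : forall x y : {x | x \in sc_lang},
    ~~ infix (val x) (val y) -> sc_pi x y = 0%R;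
  sc_pi_refl : forall x, sc_pi x x = 1%R;
  sc_pi_comp : forall x y z, (sc_pi y z * sc_pi x y <= sc_pi x z)%R
}.

Definition sc_text (R : realType) (L : syntax_category R) : Type :=
  {x | x \in @sc_lang R L}.

(* [lne] is the extended logarithm, so that - lne 0 = +oo. *)
Definition metric_hom (R : realType) (L : syntax_category R)
  (x y : sc_text L) : \bar R := - lne (sc_pi x y)%:E.

Lemma metric_hom_ge0 (R : realType) (L : syntax_category R)
  (x y : sc_text L) : 0 <= metric_hom x y.
Proof. by rewrite /metric_hom oppe_ge0 lne_le0 lee_fin sc_pi_le1. Qed.

Lemma metric_hom_refl (R : realType) (L : syntax_category R)
  (x : sc_text L) : metric_hom x x = 0.
Proof. by rewrite /metric_hom sc_pi_refl lne1 oppe0. Qed.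

Lemma metric_hom_triangle (R : realType) (L : syntax_category R)
  (x y z : sc_text L) : metric_hom x z <= metric_hom x y + metric_hom y z.
Proof.
have lne0 : lne (0%:E : \bar R) = -oo by rewrite le0_lneNy.
have [xy0|xy0] := eqVneq (sc_pi x y) 0%R.
  rewrite {2}/metric_hom xy0 lne0 addye ?leey //.
  by have := metric_hom_ge0 y z; case: metric_hom.
have [yz0|yz0] := eqVneq (sc_pi y z) 0%R.
  rewrite {3}/metric_hom yz0 lne0 addey ?leey //.
  by have := metric_hom_ge0 x y; case: metric_hom.
have pxy : (0 < sc_pi x y)%R by rewrite lt_neqAle eq_sym xy0 sc_pi_ge0.
have pyz : (0 < sc_pi y z)%R by rewrite lt_neqAle eq_sym yz0 sc_pi_ge0.
have pM : (0 < sc_pi y z * sc_pi x y)%R by rewrite mulr_gt0.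
have pxz : (0 < sc_pi x z)%R := lt_le_trans pM (sc_pi_comp x y z).
rewrite /metric_hom !lne_EFin // -!EFinN -EFinD lee_fin -opprD lerN2.
by rewrite addrC -lnM ?posrE // ler_ln ?posrE // sc_pi_comp.
Qed.

Definition metric_of (R : realType) (L : syntax_category R) : gmetric R :=
  GMetric (@metric_hom_ge0 R L) (@metric_hom_refl R L)
          (@metric_hom_triangle R L).

Record copresheaf (R : realType) (M : gmetric R) := Copresheaf {
  cop_fun :> gm_obj M -> \bar R;
  cop_ge0 : forall x, 0 <= cop_fun x;
  cop_hom : forall x y, ihom (cop_fun x) (cop_fun y) <= gm_hom x y
}.

(* The supremum is taken in [0, +oo]: adjoining 0 has no effect when M is
   nonempty and makes the supremum over an empty M equal to 0 (ereal_sup set0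
   is -oo). *)
Definition cop_dist (R : realType) (M : gmetric R) (f g : copresheaf M) :
  \bar R := ereal_sup (0 |` range (fun x => ihom (f x) (g x))).

Lemma ihomxx (R : realType) (a : \bar R) : 0 <= a -> ihom a a = 0.
Proof.
case: a => [r| |] // _; rewrite /ihom.
  by rewrite -EFinB subrr maxxx.
by apply/max_idPr; rewrite /= leNye.
Qed.

Lemma ihom_triangle (R : realType) (a b c : \bar R) :
  0 <= a -> 0 <= b -> 0 <= c -> ihom a c <= ihom a b + ihom b c.
Proof.
have ih0 (u v : \bar R) : 0 <= ihom u v by rewrite /ihom le_max lexx orbT.
move=> a0 b0 c0; rewrite {1}/ihom ge_max adde_ge0 // andbT.
case: a b c a0 b0 c0 => [a| |] [b| |] [c| |] // _ _ _;
  rewrite ?leNye //.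
- apply: (@le_trans _ _ ((b%:E - a%:E) + (c%:E - b%:E))).
    by rewrite -!EFinB -EFinD lee_fin (addrC (b - a)%R) addrA subrK.
  by apply: leeD; rewrite /ihom le_max lexx.
- rewrite [ihom b%:E _]/ihom.
  have -> : (+oo - b%:E : \bar R) = +oo by [].
  by rewrite maxye addey ?leey //; have := ih0 a%:E b%:E; case: ihom.
- rewrite [ihom a%:E _]/ihom.
  have -> : (+oo - a%:E : \bar R) = +oo by [].
  by rewrite maxye addye ?leey //; have := ih0 +oo c%:E; case: ihom.
- rewrite [ihom a%:E _]/ihom.
  have -> : (+oo - a%:E : \bar R) = +oo by [].
  by rewrite maxye addye ?leey //; have := ih0 +oo +oo; case: ihom.
Qed.

Lemma cop_dist_ge0 (R : realType) (M : gmetric R) (f g : copresheaf M) :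
  0 <= cop_dist f g.
Proof. by apply: ereal_sup_ubound; left. Qed.

Lemma cop_dist_refl (R : realType) (M : gmetric R) (f : copresheaf M) :
  cop_dist f f = 0.
Proof.
apply/eqP; rewrite eq_le cop_dist_ge0 andbT; apply: ge_ereal_sup.
by move=> _ [->|[x _ <-]] //; rewrite ihomxx ?cop_ge0.
Qed.

Lemma cop_dist_triangle (R : realType) (M : gmetric R)
  (f g h : copresheaf M) : cop_dist f h <= cop_dist f g + cop_dist g h.
Proof.
apply: ge_ereal_sup => _ [->|[x _ <-]]; first by rewrite adde_ge0 ?cop_dist_ge0.
apply: le_trans (ihom_triangle (cop_ge0 f x) (cop_ge0 g x) (cop_ge0 h x)) _.
by apply: leeD; apply: ereal_sup_ubound; right; exists x.
Qed.

Definition copresheaves (R : realType) (M : gmetric R) : gmetric R :=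
  GMetric (@cop_dist_ge0 R M) (@cop_dist_refl R M) (@cop_dist_triangle R M).

(* P is a limit (resp. Q a colimit) of the two-object discrete diagram X, Y
   with weights w1, w2. *)
Definition is_weighted_product (R : realType) (C : gmetric R)
  (w1 : \bar R) (X : C) (w2 : \bar R) (Y : C) (P : C) : Prop :=
  forall Z : C,
    gm_hom Z P = maxe (ihom w1 (gm_hom Z X)) (ihom w2 (gm_hom Z Y)).

Definition is_weighted_coproduct (R : realType) (C : gmetric R)
  (w1 : \bar R) (X : C) (w2 : \bar R) (Y : C) (Q : C) : Prop :=
  forall Z : C,
    gm_hom Q Z = maxe (ihom w1 (gm_hom X Z)) (ihom w2 (gm_hom Y Z)).

(* Main.v *)
Require Import Defs.
From mathcomp Require Import all_boot all_order all_algebra.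
From mathcomp Require Import all_classical all_reals all_analysis.

(** Everything follows from the adjunction [ihom a b <= c] iff [b <= a + c]:
    by it, both sides of a universal property lie below the same [c], hence
    agree.  The universal property determines the object pointwise because
    distance 0 between copresheaves is the reverse pointwise order, which is
    antisymmetric. *)

Import Order.TTheory.

Local Open Scope classical_set_scope.
Local Open Scope ereal_scope.

Lemma ihom_ge0 (R : realType) (a b : \bar R) : 0 <= ihom a b.
Proof. by rewrite /ihom le_max lexx orbT. Qed.

Lemma ihom_le (R : realType) (a b c : \bar R) : 0 <= a -> 0 <= c ->
  (ihom a b <= c) = (b <= a + c).
Proof.
move=> a0 c0; rewrite /ihom ge_max c0 andbT.
case: a a0 => [a| |] // a0; first by rewrite leeBlDl.
(* For [a = +oo] both sides are true: [b - +oo] is [-oo] even at [b = +oo], and [c], being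
   nonnegative, is not [-oo], so [+oo + c = +oo]. *)
have -> : b - +oo = -oo by case: b.
by rewrite leNye addye ?leey // gt_eqF // (lt_le_trans _ c0).
Qed.

(** Testing against nonnegative [c] suffices, as [a] and [b] are themselves such tests; the
    adjunction is available only for those. *)
Lemma ge0_eq_le (R : realType) (a b : \bar R) : 0 <= a -> 0 <= b ->
  (forall c, 0 <= c -> (a <= c) = (b <= c)) -> a = b.
Proof. by move=> a0 b0 H; apply/le_anti; rewrite H // lexx -H // lexx. Qed.

Section Copresheaves.
Context {R : realType} {M : gmetric R}.
Implicit Types f g P Q Z : copresheaf M.

Lemma cop_le f x y : f y <= f x + gm_hom x y.
Proof. by rewrite -ihom_le ?cop_hom ?cop_ge0 ?gm_hom_ge0. Qed.

(** The adjunction applied pointwise under the supremum; the adjoined 0 lies below [c]. *)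
Lemma cop_dist_le f g c : 0 <= c ->
  cop_dist f g <= c <-> forall x, g x <= f x + c.
Proof.
move=> c0; split=> [fgc x|fgc].
  rewrite -ihom_le ?cop_ge0 //; apply: le_trans fgc.
  by apply: ereal_sup_ubound; right; exists x.
apply: ge_ereal_sup => _ [->//|[x _ <-]].
by rewrite ihom_le ?cop_ge0.
Qed.

Lemma cop_dist0_anti f g : cop_dist f g = 0 -> cop_dist g f = 0 -> f =1 g.
Proof.
move=> fg gf x; apply/le_anti/andP; split.
  by rewrite -[leRHS]adde0; apply: (cop_dist_le g f 0 _).1; rewrite ?gf.
by rewrite -[leRHS]adde0; apply: (cop_dist_le f g 0 _).1; rewrite ?fg.
Qed.

(** A Yoneda argument: taking [Z] to be [P] gives [cop_dist P P' = cop_dist P P = 0], and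
    symmetrically. *)
Lemma weighted_product_unique {w1 w2 f g P P'} :
  @is_weighted_product R (copresheaves M) w1 f w2 g P ->
  @is_weighted_product R (copresheaves M) w1 f w2 g P' -> P =1 P'.
Proof.
move=> HP HP'; apply: cop_dist0_anti.
  by rewrite -(cop_dist_refl P) [LHS]HP' -[LHS]HP.
by rewrite -(cop_dist_refl P') [LHS]HP -[LHS]HP'.
Qed.

Lemma weighted_coproduct_unique {w1 w2 f g Q Q'} :
  @is_weighted_coproduct R (copresheaves M) w1 f w2 g Q ->
  @is_weighted_coproduct R (copresheaves M) w1 f w2 g Q' -> Q =1 Q'.
Proof.
move=> HQ HQ'; apply: cop_dist0_anti.
  by rewrite -(cop_dist_refl Q') [LHS]HQ -[LHS]HQ'.
by rewrite -(cop_dist_refl Q) [LHS]HQ' -[LHS]HQ.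
Qed.

Section Weighted.
Context (w1 w2 : \bar R) (w1_ge0 : 0 <= w1) (w2_ge0 : 0 <= w2).
Context (f g : copresheaf M).

(** Each component is truncated separately, so that the adjunction applies to it directly. *)
Definition wprod_fun (c : M) : \bar R := maxe (ihom w1 (f c)) (ihom w2 (g c)).

Lemma wprod_ge0 c : 0 <= wprod_fun c.
Proof. by rewrite le_max ihom_ge0. Qed.

Lemma wprod_le c d : 0 <= d ->
  (wprod_fun c <= d) = (f c <= w1 + d) && (g c <= w2 + d).
Proof. by move=> d0; rewrite ge_max !ihom_le. Qed.

Lemma wprod_hom x y : ihom (wprod_fun x) (wprod_fun y) <= gm_hom x y.
Proof.
rewrite ihom_le ?wprod_ge0 ?gm_hom_ge0 //.
rewrite wprod_le ?adde_ge0 ?wprod_ge0 ?gm_hom_ge0 // !addeA.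
(* The unit of the adjunction: [wprod_le] with [d] equal to [wprod_fun x]. *)
have /andP[fP gP] : (f x <= w1 + wprod_fun x) && (g x <= w2 + wprod_fun x).
  by rewrite -wprod_le ?wprod_ge0.
by apply/andP; split; apply: le_trans (cop_le _ x y) _; apply: leeD.
Qed.

Definition wprod : copresheaf M := Copresheaf wprod_ge0 wprod_hom.

(** Being at most [c] means, on either side, [f x <= w1 + Z x + c] and [g x <= w2 + Z x + c] for all
    [x], up to reordering the sums. *)
Lemma wprodP : @is_weighted_product R (copresheaves M) w1 f w2 g wprod.
Proof.
move=> Z; apply: ge0_eq_le => [||c c0]; rewrite ?gm_hom_ge0 1?le_max ?ihom_ge0 //.
rewrite ge_max !ihom_le //; apply/idP/andP => /=.
  move=> /(cop_dist_le Z wprod c c0) H.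
  by split; apply/cop_dist_le => [|x]; rewrite ?adde_ge0 // addeCA;
    have := H x; rewrite /= wprod_le ?adde_ge0 ?cop_ge0 // => /andP[].
move=> [/cop_dist_le Hf /cop_dist_le Hg]; apply/cop_dist_le => //= x.
rewrite wprod_le ?adde_ge0 ?cop_ge0 // !(addeCA _ (Z x)).
by rewrite Hf ?Hg ?adde_ge0.
Qed.

Definition wcoprod_fun (c : M) : \bar R := mine (f c + w1) (g c + w2).

Lemma wcoprod_ge0 c : 0 <= wcoprod_fun c.
Proof. by rewrite le_min !adde_ge0 ?cop_ge0. Qed.

(** Adding [b] is monotone, so the bound by the smaller branch implies the other one. *)
Lemma le_wcoprodD c (a b : \bar R) :
  (a <= wcoprod_fun c + b) = (a <= f c + w1 + b) && (a <= g c + w2 + b).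
Proof.
rewrite /wcoprod_fun; case: (leP (f c + w1) (g c + w2)) => [|/ltW] le12.
  by rewrite andb_idr // => /le_trans; apply; apply: leeD.
by rewrite andb_idl // => /le_trans; apply; apply: leeD.
Qed.

Lemma wcoprod_hom x y : ihom (wcoprod_fun x) (wcoprod_fun y) <= gm_hom x y.
Proof.
rewrite ihom_le ?wcoprod_ge0 ?gm_hom_ge0 // le_wcoprodD
  !(addeAC _ _ (gm_hom x y)).
rewrite /wcoprod_fun !ge_min.
(* Each branch at [x] is compared with the same branch at [y]. *)
by apply/andP; split; apply/orP; [left|right]; rewrite leeD ?cop_le.
Qed.

Definition wcoprod : copresheaf M := Copresheaf wcoprod_ge0 wcoprod_hom.

(** Here both bounds by [c] unfold to [Z x <= f x + w1 + c] and [Z x <= g x + w2 + c] for all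
    [x]. *)
Lemma wcoprodP : @is_weighted_coproduct R (copresheaves M) w1 f w2 g wcoprod.
Proof.
move=> Z; apply: ge0_eq_le => [||c c0]; rewrite ?gm_hom_ge0 1?le_max ?ihom_ge0 //.
rewrite ge_max !ihom_le //; apply/idP/andP => /=.
  move=> /(cop_dist_le wcoprod Z c c0) H.
  by split; apply/cop_dist_le => [|x]; rewrite ?adde_ge0 // addeA;
    have := H x; rewrite /= le_wcoprodD => /andP[].
move=> [/cop_dist_le Hf /cop_dist_le Hg]; apply/cop_dist_le => //= x.
by rewrite le_wcoprodD -!addeA Hf ?Hg ?adde_ge0.
Qed.

End Weighted.
End Copresheaves.

Theorem theorem5 (R : realType) (L : syntax_category R)
  (f g : copresheaf (metric_of L)) (w1 w2 : \bar R)
  (w1_ge0 : 0 <= w1) (w2_ge0 : 0 <= w2) :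
  ((exists P : copresheaf (metric_of L),
      @is_weighted_product R (copresheaves (metric_of L)) w1 f w2 g P) /\
   (forall P : copresheaf (metric_of L),
      @is_weighted_product R (copresheaves (metric_of L)) w1 f w2 g P ->
      forall c : metric_of L, P c = maxe (maxe (f c - w1) (g c - w2)) 0)) /\
  ((exists Q : copresheaf (metric_of L),
      @is_weighted_coproduct R (copresheaves (metric_of L)) w1 f w2 g Q) /\
   (forall Q : copresheaf (metric_of L),
      @is_weighted_coproduct R (copresheaves (metric_of L)) w1 f w2 g Q ->
      forall c : metric_of L, Q c = mine (f c + w1) (g c + w2))).
Proof.
have HP := wprodP w1 w2 w1_ge0 w2_ge0 f g.
have HQ := wcoprodP w1 w2 w1_ge0 w2_ge0 f g.
split; split.
- by exists (wprod w1 w2 w1_ge0 w2_ge0 f g).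
- move=> P /weighted_product_unique/(_ HP) PE c.
  (* The two truncations at 0 merge into one. *)
  by rewrite PE /= /wprod_fun /ihom -maxA (maxC 0) -maxA maxxx maxA.
- by exists (wcoprod w1 w2 w1_ge0 w2_ge0 f g).
- by move=> Q /weighted_coproduct_unique/(_ HQ) QE c; rewrite QE.
Qed.
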